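(* Let $X$ be an $F$-space, $Y$ a separable $F$-space and let $\mathcal{T}_i=(T_{i,n})_{n\in \mathbb{N}}$, $i\in\mathbb{N}$, be countably many sequences of continuous linear operators from $X$ to $Y$. Assume that there exist a dense subset $Y_0$ of $Y$, mappings $S_{i,n}:Y_0\to X$, $i,n\in\mathbb{N}$, and a real number $c>1$ such that for every $y\in Y_0$: (1) the series $\sum_{0\leq n\leq m}T_{i,m}(S_{i,m-n}(y))$ converges unconditionally, uniformly for $m\in \mathbb{N}$ and $i\in \mathbb{N}$; (2) the series $\sum_{n\geq 0}T_{i,m}(S_{i,m+n}(y))$ converges unconditionally, uniformly for $m\in \mathbb{N}$ and $i\in \mathbb{N}$; (3) the series $\sum_{n\geq (c-1)m}T_{i,m}(S_{j,m+n}(y))$ converges unconditionally, uniformly for $m\in \mathbb{N}$ and $i\neq j\in \mathbb{N}$; (4) the series $\sum_{\frac{c-1}{c}m\leq n\leq m}T_{i,m}(S_{j,m-n}(y))$ converges unconditionally, uniformly for $m\in \mathbb{N}$ and $i\neq j\in \mathbb{N}$; (5) the series $\sum_{n\geq 0}S_{i,n}(y)$ converges unconditionally, uniformly for $i\in \mathbb{N}$; (6) the sequence $(T_{i,n}(S_{i,n}(y)))_{n\in\mathbb{N}}$ converges to $y$, uniformly for $i\in \mathbb{N}$. Then there exists a vector $x\in X$ which is frequently universal for every $\mathcal{T}_i$, $i\in \mathbb{N}$.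
   Context: $\mathbb{N}=\{0,1,2,\ldots\}$. An $F$-space is a complete metrizable topological vector space; $\Vert\cdot\Vert$ denotes an $F$-norm defining its topology. Uniform unconditional convergence: given a set $\Lambda$ and vectors $x_{\lambda,n}$ ($\lambda\in\Lambda$, $n\in\mathbb{N}$), the series $\sum_{n\in\mathbb{N}}x_{\lambda,n}$ converges unconditionally, uniformly for $\lambda\in\Lambda$, if for every $\varepsilon>0$ there is $N\in\mathbb{N}$ such that for every finite set $F\subset\{N,N+1,\ldots\}$ one has $\Vert\sum_{n\in F}x_{\lambda,n}\Vert<\varepsilon$ for every $\lambda\in\Lambda$. When the summation index $n$ is restricted to a range depending on the parameters (as in $\sum_{0\le n\le m}$ or $\sum_{n\ge (c-1)m}$), the terms with $n$ outside this range are taken to be $0$. For $E\subset\mathbb{N}$, the lower density is $\underline{d}(E)=\liminf_{n\to\infty}\frac{\mathrm{card}([0,n]\cap E)}{n+1}$. A vector $x\in X$ is frequently universal for a sequence $\mathcal{T}=(T_n)_{n\in\mathbb{N}}$ of continuous linear operators from $X$ to $Y$ if for every non-empty open set $U\subset Y$, $\underline{d}(\{n\in\mathbb{N}: T_n(x)\in U\})>0$. *)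

(* Defs.v *)
From HB Require Import structures.
From mathcomp Require Import all_boot all_order all_algebra.
From mathcomp Require Import finmap complex.
From mathcomp Require Import all_classical all_reals all_analysis.
Set Implicit Arguments.
Unset Strict Implicit.
Unset Printing Implicit Defensive.
Import Order.TTheory GRing.Theory Num.Theory.
Import numFieldNormedType.Exports.
Local Open Scope classical_set_scope.
Local Open Scope ring_scope.

Variant scalars := real_scalars | complex_scalars.

Definition scalar_field (R : realType) (s : scalars) : numFieldType :=
  match s with
  | real_scalars => R
  | complex_scalars => R[i]
  end.

Section FSpaces.
Context (R : realType) (K : numFieldType) (X : topologicalLmodType K).

Definition metrizable : Prop :=
  exists d : X -> X -> R,
    [/\ forall x y, 0 <= d x y,
        forall x y, d x y = 0 <-> x = y,
        forall x y, d x y = d y x,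
        forall x y z, d x z <= d x y + d y z &
        forall x (A : set X),
          nbhs x A <-> exists2 e : R, 0 < e & [set y | d x y < e] `<=` A].

(* Cauchy filters and completeness refer to the translation-invariant
   uniformity of the topological vector space. The library's UniformLmodule is
   not used: it asks that scaling K * X -> X be uniformly continuous, which
   fails unless X is trivial. *)
Definition tvs_cauchy (F : set_system X) : Prop :=
  forall U : set X, nbhs 0 U ->
    exists2 A : set X, F A & forall x y, A x -> A y -> U (x - y).

Definition tvs_complete : Prop :=
  forall F : set_system X, ProperFilter F -> tvs_cauchy F ->
    exists l : X, F --> l.

Definition F_space : Prop := tvs_complete /\ metrizable.

(* q is an F-norm defining the topology of X. *)
Record F_norm (q : X -> R) : Prop := {
  F_norm_ge0 : forall x, 0 <= q x ;
  F_norm_eq0 : forall x, q x = 0 -> x = 0 ;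
  F_norm_triangle : forall x y, q (x + y) <= q x + q y ;
  F_norm_scale : forall (k : K) x, `|k| <= 1 -> q (k *: x) <= q x ;
  F_norm_scale0 : forall x, q (k *: x) @[k --> (0 : K^o)] --> (0 : R) ;
  F_norm_nbhs : forall x (A : set X),
    nbhs x A <-> exists2 e : R, 0 < e & [set y | q (y - x) < e] `<=` A
}.

Definition uniformly_unconditionally_convergent (q : X -> R)
    (L : Type) (Lam : set L) (u : L -> nat -> X) : Prop :=
  forall e : R, 0 < e -> exists N : nat,
    forall F : {fset nat}, (forall n, n \in F -> (N <= n)%N) ->
      forall l, Lam l -> q (\sum_(n <- F) u l n) < e.

End FSpaces.

Definition separable (Y : topologicalType) : Prop :=
  exists2 D : set Y, countable D & dense D.

Definition lower_density (R : realType) (E : set nat) : \bar R :=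
  limn_einf (fun n : nat =>
    ((#|[pred k : 'I_n.+1 | nat_of_ord k \in E]|%:R / n.+1%:R : R)%:E)).

Definition frequently_universal (R : realType) (X : Type) (Y : topologicalType)
    (T : nat -> X -> Y) (x : X) : Prop :=
  forall U : set Y, open U -> U !=set0 ->
    (0 < lower_density R [set n | U (T n x)])%E.

(* Main.v *)
Require Import Defs.
From HB Require Import structures.
From mathcomp Require Import all_boot all_order all_algebra.
From mathcomp Require Import finmap complex.
From mathcomp Require Import all_classical all_reals all_analysis.
From mathcomp Require Import zify lra ring.
Set Implicit Arguments.
Unset Strict Implicit.
Unset Printing Implicit Defensive.
Import Order.TTheory GRing.Theory Num.Theory.
Import numFieldNormedType.Exports.
Local Open Scope classical_set_scope.
Local Open Scope ring_scope.

(** The vector is x = \sum_n z_n, where z_n = S_{j_p,n}(y_p) when n lies in the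
    set E_p, and z_n = 0 when n lies in no E_p. The pairs (j_p, y_p) run
    through all sequences j and all terms of a dense sequence of Y0, each pair
    occurring for arbitrarily large p, and the pairwise disjoint sets E_p
    have positive lower density.

    If m is in E_p, then T_{j_p,m} x should be close to y_p. By H6 the diagonal
    term T_{j_p,m} z_m is. The other terms split according to the set E_q
    containing their index n, and H1-H4 bound the sum over one E_q provided
    that |n - m| is large and, when j_q <> j_p, that n and m differ at least by
    the factor c: this is what restricts the ranges in H3 and H4
    (sum_off_diagonal_small). A gap of size max(N_p, N_q) between points of E_p
    and E_q, with N growing fast enough, makes that bound 4^-max(p,q), which is
    at most 2^-p 2^-q; summing over q leaves an error O(2^-p)
    (F_norm_sum_labels). The same computation with H5 shows that the series
    defining x is Cauchy. Given an open set U and i, choose k such that U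
    contains a ball around the k-th point of the dense sequence, and then p
    large with (j_p, y_p) = (i, that point): T_{i,m} x is in U for all m in E_p.

    It remains to find the sets E_p (exists_separated_labels). Cut the positive
    integers into the blocks [C^t, C^(t+1)) with C >= c and C >= 4. Odd blocks
    stay empty, so that points of distinct nonempty blocks differ by the factor
    C. The block t is given to E_p when 2^(p+1) is the exact power of 2 in t;
    these blocks recur with period 2^(p+2), so that one of them is wholly below
    a given large n and contains a fixed proportion of [0,n]. Inside its blocks
    E_p consists of multiples of a large number M_p. The family (E_p) is encoded
    by a labelling of the integers by optional indices, which makes it
    disjoint. *)

(** * Separated sets of positive lower density *)

Lemma logn2_odd_multiple (a u : nat) : logn 2 (2 ^ a * u.*2.+1) = a.
Proof.
rewrite lognM ?expn_gt0// pfactorK// logn_coprime ?addn0//.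
by rewrite coprime2n /= odd_double.
Qed.

(** The integers t with [logn 2 t = a] are the odd multiples of 2^a, hence
    recur with period 2^(a+1). *)
Lemma exists_logn2_near (a t0 : nat) : (2 ^ a < t0)%N ->
  exists t, [/\ (t < t0)%N, (t0 <= t + 2 ^ a.+1)%N & logn 2 t = a].
Proof.
set P := (2 ^ a)%N => Pt0.
have P_gt0 : (0 < P)%N by rewrite expn_gt0.
(* u is the largest integer with P (2 u + 1) < t0. *)
set u := ((t0.-1 - P) %/ P.*2)%N.
exists (P * u.*2.+1)%N; split; last exact: logn2_odd_multiple.
- have := leq_divM (t0.-1 - P) P.*2.
  by rewrite -/u; nia.
- have : (t0.-1 - P < u.+1 * P.*2)%N by rewrite ltn_ceil// double_gt0.
  by rewrite expnS -/P; nia.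
Qed.

(** The index of the set containing n, if any. Only even blocks t are used,
    since [logn 2 t = p.+1]. The condition [(M p).*2 <= n] turns the geometric gap
    between blocks into an additive gap of at least [M p]. *)
Definition block_label (C : nat) (M : nat -> nat) (n : nat) : option nat :=
  if logn 2 (trunc_log C n) is p.+1 then
    if ((M p).*2 <= n)%N && (M p %| n)%N then Some p else None
  else None.

Lemma block_labelP C M n p : block_label C M n = Some p <->
  [/\ logn 2 (trunc_log C n) = p.+1, ((M p).*2 <= n)%N & (M p %| n)%N].
Proof.
rewrite /block_label; case: (logn _ _) => [|r]; first by split=> // -[].
split=> [|[[->] -> ->] //].
by case: ifP => // /andP[? ?] [<-].
Qed.

(** Distinct labels lie in distinct even blocks t < t', so the whole block t.+1
    separates the two points. *)
Lemma block_label_geometric C M m n p q : (1 < C)%N ->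
  block_label C M m = Some p -> block_label C M n = Some q -> p <> q ->
  (m < n)%N -> (C * m <= n)%N.
Proof.
move=> C_gt1 /block_labelP[tm pm _] /block_labelP[tn pn _] pq mn.
have even_of t r : logn 2 t = r.+1 -> ~~ odd t.
  by move=> tr; rewrite -dvdn2 -(expn1 2) pfactor_dvdn ?tr//; case: t tr.
have := even_of _ _ tm; have := even_of _ _ tn.
have neq : trunc_log C m != trunc_log C n.
  by apply/eqP => e; apply: pq; move: tm; rewrite e tn => -[].
have := leq_trunc_log C (ltnW mn).
move: neq (trunc_log_ltn m C_gt1) (@trunc_logP C n C_gt1).
move: (trunc_log C m) (trunc_log C n) => t t' neq mt t'n tt' et' et.
have {}t'n := t'n (leq_ltn_trans (leq0n m) mn).
have tt2 : (t.+2 <= t')%N by lia.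
rewrite (leq_trans _ t'n)// (leq_trans _ (leq_pexp2l (ltnW C_gt1) tt2))//.
by rewrite (expnS C t.+1) leq_mul2l ltnW ?orbT.
Qed.

(** Let M <= C^t and a = floor(C^t / M) + 1. The multiples M a, ..., M (2a-1)
    all lie in the block t, because C^t < M a and 2 M a <= 4 C^t <= C^(t+1).
    Their number a is at least C^t / M, and C^t is at least a constant multiple
    of n when t is chosen close to the block of n. *)
Lemma block_label_count C M p : (3 < C)%N -> (0 < M p)%N ->
  exists K n0, forall n, (n0 <= n)%N ->
    (n < K * count (fun k => block_label C M k == Some p) (iota 0 n.+1))%N.
Proof.
move=> C_gt3 M_gt0; have C_gt1 : (1 < C)%N by lia.
set D := (2 ^ p.+2)%N.
exists (M p * C ^ D.+1)%N, (C ^ ((M p).*2 + D.+1))%N => n n_ge.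
have n_gt0 : (0 < n)%N by rewrite (leq_trans _ n_ge)// expn_gt0 ltnW.
have t0_ge : ((M p).*2 + D.+1 <= trunc_log C n)%N by exact: trunc_log_max.
have := trunc_log_ltn n C_gt1; have := trunc_logP C_gt1 n_gt0.
move: (trunc_log C n) t0_ge => t0 t0_ge nt0 ltn.
have /exists_logn2_near[t [tt0 t0t lt]] : (2 ^ p.+1 < t0)%N.
  by move: t0_ge; rewrite /D (expnS 2 p.+1); lia.
rewrite -/D in t0t.
have MCt : ((M p).*2 <= C ^ t)%N.
  rewrite (@leq_trans t)//; first by lia.
  by rewrite ltnW// ltn_expl.
set a := (C ^ t %/ M p).+1%N.
have a_lo : (C ^ t <= a * M p)%N by rewrite ltnW// ltn_ceil.
have a_hi : ((a * M p).*2 <= C ^ t.+1)%N.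
  have := leq_divM (C ^ t) (M p); rewrite /a expnS; nia.
have Ctn : (C ^ t.+1 <= n)%N by rewrite (leq_trans _ nt0)// leq_pexp2l// ltnW.
have a_le : (a <= count (fun k => block_label C M k == Some p) (iota 0 n.+1))%N.
  rewrite -size_filter -(size_iota a a) -(size_map (muln (M p))).
  apply: uniq_leq_size.
    rewrite map_inj_uniq ?iota_uniq// => x y /eqP.
    by rewrite eqn_pmul2l// => /eqP.
  move=> z /mapP[x]; rewrite mem_iota => /andP[ax xa] -> {z}.
  have lo : (C ^ t <= M p * x)%N by nia.
  have hi : (M p * x < C ^ t.+1)%N by nia.
  rewrite mem_filter mem_iota add0n leq0n /= ltnS.
  rewrite (leq_trans (ltnW hi) Ctn) andbT.
  apply/eqP/block_labelP; split.
  - by rewrite (trunc_log_eq C_gt1 (n := t))// lo.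
  - exact: leq_trans lo.
  - exact: dvdn_mulr.
apply: (leq_trans ltn); apply: (@leq_trans (C ^ D.+1 * C ^ t)%N).
  by rewrite -expnD leq_pexp2l ?(ltnW C_gt1)//; lia.
rewrite mulnC mulnAC leq_mul2r; apply/orP; right.
by rewrite (leq_trans a_lo)// mulnC leq_mul2l a_le orbT.
Qed.

(** Apply [block_label] with C at least 4 and at least c, and with M = N + 1 so
    that M is positive. Within one label the additive gap comes from divisibility by M;
    between two labels, it comes from the factor C >= 2. *)
Lemma exists_separated_labels (R : realType) (c : R) (N : nat -> nat) :
  exists lab : nat -> option nat,
  [/\ forall n p, lab n = Some p -> (N p <= n)%N,
      forall m n p q, lab m = Some p -> lab n = Some q -> (m < n)%N ->
        (m + maxn (N p) (N q) <= n)%N,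
      forall m n p q, lab m = Some p -> lab n = Some q -> (m < n)%N -> p <> q ->
        c * m%:R <= n%:R &
      forall p, exists K n0, forall n, (n0 <= n)%N ->
        (n < K * count (fun k => lab k == Some p) (iota 0 n.+1))%N].
Proof.
set C := maxn 4 (Num.truncn c).+1.
have C_gt3 : (3 < C)%N by rewrite leq_max.
pose M p := (N p).+1.
exists (block_label C M); split.
- by move=> n p /block_labelP[_ Mn _]; rewrite /M in Mn; lia.
- move=> m n p q lm ln mn.
  have [pq|/eqP pq] := eqVneq p q.
    move: lm ln; rewrite -pq maxnn.
    move=> /block_labelP[_ _ dm] /block_labelP[_ _ dn].
    have : (M p <= n - m)%N by rewrite dvdn_leq ?subn_gt0// dvdn_sub.
    by rewrite /M; lia.
  have := block_label_geometric (ltnW (ltnW C_gt3)) lm ln pq mn.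
  have Cm : (2 * m <= C * m)%N by rewrite leq_mul2r; lia.
  move: lm ln => /block_labelP[_ + _] /block_labelP[_ + _].
  by rewrite /M; lia.
- move=> m n p q lm ln mn pq.
  have := block_label_geometric (ltnW (ltnW C_gt3)) lm ln pq mn.
  rewrite -(ler_nat R) natrM; apply: le_trans; rewrite ler_wpM2r//.
  rewrite (@le_trans _ _ (Num.truncn c).+1%:R)//.
    by rewrite ltW// truncnS_gt.
  by rewrite ler_nat leq_maxr.
- by move=> p; apply: block_label_count.
Qed.

Lemma lower_density_gt0 (R : realType) (A : set nat) (P : pred nat) K n0 :
  (forall k, P k -> A k) ->
  (forall n, (n0 <= n)%N -> (n < K * count P (iota 0 n.+1))%N) ->
  (0 < lower_density R A)%E.
Proof.
move=> PA cnt; have K_gt0 : (0 < K)%N.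
  by have := cnt _ (leqnn n0); case: (K) => //; rewrite mul0n ltn0.
rewrite /lower_density limn_einf_lim.
apply: (@lt_le_trans _ _ (K%:R^-1)%:E); first by rewrite lte_fin invr_gt0 ltr0n.
apply: lime_ge; first exact: is_cvg_einfs.
near=> n; apply: le_ereal_inf_tmp => _ [k /= nk <-].
rewrite lee_fin ler_pdivlMr// mulrC ler_pdivrMr ?ltr0n// -natrM ler_nat mulnC.
have n0k : (n0 <= k)%N by rewrite (leq_trans _ nk)//; near: n; exists n0.
apply: (leq_trans (cnt _ n0k)); rewrite leq_mul2l; apply/orP; right.
rewrite -val_enum_ord count_map -size_filter cardE.
apply: uniq_leq_size; first by rewrite filter_uniq// enum_uniq.
move=> j; rewrite mem_filter mem_enum => /andP[/= Pj _].
by rewrite mem_enum inE /=; exact: PA.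
Unshelve. all: by end_near. Qed.

(** * Consequences of the axioms of an F-norm *)

Lemma F_norm0 (R : realType) (K : numFieldType) (X : topologicalLmodType K)
  (q : X -> R) (qF : F_norm q) : q 0 = 0.
Proof.
apply/eqP; rewrite eq_le (F_norm_ge0 qF) andbT leNgt; apply/negP => q0.
have /nbhs_singleton /= : nbhs (0 : X) [set y | q (y - 0) < q 0].
  by apply/(F_norm_nbhs qF); exists (q 0).
by rewrite subr0 ltxx.
Qed.

Lemma F_normN (R : realType) (K : numFieldType) (X : topologicalLmodType K)
  (q : X -> R) (qF : F_norm q) x : q (- x) = q x.
Proof.
have le y : q (- y) <= q y.
  by rewrite -scaleN1r; apply: (F_norm_scale qF); rewrite normrN1.
by apply/eqP; rewrite eq_le le -{1}(opprK x) le.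
Qed.

Lemma F_norm_distC (R : realType) (K : numFieldType)
  (X : topologicalLmodType K) (q : X -> R) (qF : F_norm q) x y :
  q (x - y) = q (y - x).
Proof. by rewrite -(F_normN qF) opprB. Qed.

Lemma F_norm_sum (R : realType) (K : numFieldType) (X : topologicalLmodType K)
  (q : X -> R) (qF : F_norm q) (I : Type) (r : seq I) (z : I -> X) :
  q (\sum_(i <- r) z i) <= \sum_(i <- r) q (z i).
Proof.
elim/big_ind2: _ => [|a b u v au bv|//]; first by rewrite (F_norm0 qF).
exact: le_trans (F_norm_triangle qF _ _) (lerD au bv).
Qed.

Lemma F_norm_cvg_near (R : realType) (K : numFieldType)
  (X : topologicalLmodType K) (q : X -> R) (qF : F_norm q)
  (u : nat -> X) (l : X) (e : R) : u @ \oo --> l -> 0 < e ->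
  \forall n \near \oo, q (u n - l) < e.
Proof.
move=> ul e_gt0; apply: (ul [set y | q (y - l) < e]).
by apply/(F_norm_nbhs qF); exists e.
Qed.

Lemma F_norm_lim_le (R : realType) (K : numFieldType)
  (X : topologicalLmodType K) (q : X -> R) (qF : F_norm q)
  (u : nat -> X) (l a : X) (b : R) : u @ \oo --> l ->
  (\forall n \near \oo, q (u n - a) <= b) -> q (l - a) <= b.
Proof.
move=> ul ub; apply/ler_addgt0Pr => e e_gt0.
near \oo => n.
rewrite -(subrKA (u n)) (le_trans (F_norm_triangle qF _ _))// addrC lerD//.
  by near: n.
by rewrite (F_norm_distC qF) ltW//; near: n; apply: F_norm_cvg_near.
Unshelve. all: by end_near. Qed.

Lemma cauchy_series_cvg (R : realType) (K : numFieldType)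
  (X : topologicalLmodType K) (q : X -> R) (qF : F_norm q) (z : nat -> X) :
  tvs_complete X ->
  (forall e, 0 < e -> exists N, forall m n, (N <= m <= n)%N ->
     q (\sum_(m <= k < n) z k) < e) ->
  exists x : X, (fun n => \sum_(0 <= k < n) z k) @ \oo --> x.
Proof.
move=> cX cz.
apply: (cX (fmap (fun n => \sum_(0 <= k < n) z k) \oo)) => U.
move=> /(F_norm_nbhs qF)[e e_gt0 eU].
have [N HN] := cz e e_gt0.
exists [set x | exists2 n, (N <= n)%N & x = \sum_(0 <= k < n) z k].
  by exists N => // n /= Nn; exists n.
have diff m n : (m <= n)%N ->
    \sum_(0 <= k < n) z k - \sum_(0 <= k < m) z k = \sum_(m <= k < n) z k.
  by move=> mn; rewrite (big_cat_nat (n := m))//= addrAC subrr add0r.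
move=> _ _ [m Nm ->] [n Nn ->]; apply: eU; rewrite /= subr0.
have [mn|/ltnW nm] := leqP m n.
  by rewrite (F_norm_distC qF) diff// HN// Nm.
by rewrite diff// HN// Nn.
Qed.

Lemma sum_geometric_half (R : realType) Q :
  \sum_(0 <= p < Q) (2 ^- p : R) = 2 - 2 * 2 ^- Q.
Proof.
elim: Q => [|Q IH]; first by rewrite big_nil expr0 invr1 mulr1 subrr.
by rewrite big_nat_recr//= IH exprS invfM; field.
Qed.

(** Group the sum by labels and use 1 + 1/2 + 1/4 + ... = 2. *)
Lemma F_norm_sum_labels (R : realType) (K : numFieldType)
  (X : topologicalLmodType K) (q : X -> R) (qF : F_norm q)
  (lab : nat -> option nat) (z : nat -> X) (r : seq nat) (a : R) :
  0 <= a -> (forall n, lab n = None -> z n = 0) ->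
  (forall p, q (\sum_(n <- r | lab n == Some p) z n) <= a * 2 ^- p) ->
  q (\sum_(n <- r) z n) <= 2 * a.
Proof.
move=> a_ge0 z0 qz.
pose Q := \max_(n <- r) (odflt 0%N (lab n)).+1.
have -> : \sum_(n <- r) z n =
    \sum_(0 <= p < Q) \sum_(n <- r | lab n == Some p) z n.
  under [RHS]eq_bigr do rewrite big_mkcond.
  rewrite exchange_big; apply: eq_big_seq => n nr.
  case ln : (lab n) => [p|]; last by rewrite z0// big1// => p _; case: ifP.
  have pQ : (p < Q)%N.
    pose F n := (odflt 0%N (lab n)).+1.
    by have := @leq_bigmax_seq _ r xpredT F n nr isT; rewrite /F ln.
  rewrite big_mkord (bigD1 (Ordinal pQ))//= eqxx big1 ?addr0// => p'.
  rewrite -val_eqE/= => pp'; case: ifP => // /eqP[] e.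
  by rewrite e eqxx in pp'.
apply: (le_trans (F_norm_sum qF _ _)).
apply: (@le_trans _ _ (\sum_(0 <= p < Q) a * 2 ^- p)); first exact: ler_sum.
rewrite -mulr_sumr sum_geometric_half mulrC ler_wpM2r//.
by rewrite gerBl mulr_ge0// invr_ge0 exprn_ge0.
Qed.

(** * Off-diagonal sums *)

(** Duplicate-free sequences are stable under filtering and injective
    reindexing, which is how the sums are transformed below. *)
Lemma uuc_uniq_seq (R : realType) (K : numFieldType)
  (X : topologicalLmodType K) (q : X -> R) (L : Type) (Lam : set L)
  (u : L -> nat -> X) (e : R) :
  uniformly_unconditionally_convergent q Lam u -> 0 < e ->
  exists N : nat, forall r : seq nat, uniq r -> {in r, forall n, (N <= n)%N} ->
    forall l, Lam l -> q (\sum_(n <- r) u l n) < e.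
Proof.
move=> H e_gt0; have [N HN] := H e e_gt0.
exists N => r r_uniq rN l Ll.
have rF : perm_eq r [fset n in r]%fset.
  by apply: uniq_perm; rewrite ?fset_uniq// => n; rewrite inE.
by rewrite (perm_big _ rF)/=; apply: HN => // n; rewrite inE => /rN.
Qed.

(** The substitution n -> m - n turns the hypotheses into a bound on sums over
    indices n below m, with n the index of v. The inequality
    (c-1)/c m <= m - n then says that c n <= m. *)
Lemma sum_before_small (R : realType) (K : numFieldType) (X : Type)
  (Y : topologicalLmodType K) (q : Y -> R)
  (T : nat -> nat -> X -> Y) (v : nat -> nat -> X) (c : R) (e : R) :
  1 < c -> 0 < e ->
  uniformly_unconditionally_convergent q [set: nat * nat]
    (fun '(i, m) n => if (n <= m)%N then T i m (v i (m - n)%N) else 0) ->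
  uniformly_unconditionally_convergent q
    [set l : nat * nat * nat | l.1.1 <> l.1.2]
    (fun '(i, j, m) n =>
       if ((c - 1) / c * m%:R <= n%:R) && (n <= m)%N
       then T i m (v j (m - n)%N) else 0) ->
  exists N, forall i j m r, uniq r ->
    {in r, forall n, (n + N <= m)%N /\ (i <> j -> c * n%:R <= m%:R)} ->
    q (\sum_(n <- r) T i m (v j n)) < e.
Proof.
move=> c_gt1 e_gt0 /uuc_uniq_seq/(_ e_gt0)[N1 HN1].
move=> /uuc_uniq_seq/(_ e_gt0)[N2 HN2].
exists (maxn N1 N2) => i j m r r_uniq rP.
have le_m n : n \in r -> (n <= m)%N.
  by move=> /rP[/(leq_trans (leq_addr _ _))].
have r'_uniq : uniq [seq (m - n)%N | n <- r].
  by rewrite map_inj_in_uniq// => n n' /le_m ? /le_m ?; lia.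
have [ij|/eqP ij] := eqVneq i j.
  have := HN1 _ r'_uniq _ (i, m) I; rewrite big_map -ij.
  rewrite (eq_big_seq (fun n => T i m (v i n))) => [|n nr]; first apply.
    by move=> _ /mapP[n /rP[nm _] ->]; lia.
  by rewrite leq_subr subKn// le_m.
have := HN2 _ r'_uniq _ (i, j, m) ij; rewrite big_map.
rewrite (eq_big_seq (fun n => T i m (v j n))) => [|n nr]; first apply.
  by move=> _ /mapP[n /rP[nm _] ->]; lia.
rewrite leq_subr subKn ?le_m// natrB ?le_m// ifT// andbT.
have [_ /(_ ij) cnm] := rP _ nr.
rewrite mulrAC ler_pdivrMr; last exact: lt_trans c_gt1.
by rewrite mulrBl mul1r mulrBl [m%:R * c]mulrC lerD2l lerN2 mulrC.
Qed.

(** The counterpart above m: under the substitution n -> n - m, the inequality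
    (c-1) m <= n - m says that c m <= n. *)
Lemma sum_after_small (R : realType) (K : numFieldType) (X : Type)
  (Y : topologicalLmodType K) (q : Y -> R)
  (T : nat -> nat -> X -> Y) (v : nat -> nat -> X) (c : R) (e : R) :
  0 < e ->
  uniformly_unconditionally_convergent q [set: nat * nat]
    (fun '(i, m) n => T i m (v i (m + n)%N)) ->
  uniformly_unconditionally_convergent q
    [set l : nat * nat * nat | l.1.1 <> l.1.2]
    (fun '(i, j, m) n =>
       if (c - 1) * m%:R <= n%:R then T i m (v j (m + n)%N) else 0) ->
  exists N, forall i j m r, uniq r ->
    {in r, forall n, (m + N <= n)%N /\ (i <> j -> c * m%:R <= n%:R)} ->
    q (\sum_(n <- r) T i m (v j n)) < e.
Proof.
move=> e_gt0 /uuc_uniq_seq/(_ e_gt0)[N1 HN1].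
move=> /uuc_uniq_seq/(_ e_gt0)[N2 HN2].
exists (maxn N1 N2) => i j m r r_uniq rP.
have m_le n : n \in r -> (m <= n)%N.
  by move=> /rP[/(leq_trans (leq_addr _ _))].
have r'_uniq : uniq [seq (n - m)%N | n <- r].
  by rewrite map_inj_in_uniq// => n n' /m_le ? /m_le ?; lia.
have [ij|/eqP ij] := eqVneq i j.
  have := HN1 _ r'_uniq _ (i, m) I; rewrite big_map -ij.
  rewrite (eq_big_seq (fun n => T i m (v i n))) => [|n nr]; first apply.
    by move=> _ /mapP[n /rP[nm _] ->]; lia.
  by rewrite subnKC// m_le.
have := HN2 _ r'_uniq _ (i, j, m) ij; rewrite big_map.
rewrite (eq_big_seq (fun n => T i m (v j n))) => [|n nr]; first apply.
  by move=> _ /mapP[n /rP[nm _] ->]; lia.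
rewrite subnKC ?m_le// natrB ?m_le// ifT//.
have [_ /(_ ij) cmn] := rP _ nr.
by rewrite mulrBl mul1r lerD2r.
Qed.

(** This merges the four convergence hypotheses into the only form in which they
    are applied: a set of indices on both sides of m, far enough from it. *)
Lemma sum_off_diagonal_small (R : realType) (K : numFieldType) (X : Type)
  (Y : topologicalLmodType K) (q : Y -> R) (qF : F_norm q)
  (T : nat -> nat -> X -> Y) (v : nat -> nat -> X) (c : R) (e : R) :
  1 < c -> 0 < e ->
  uniformly_unconditionally_convergent q [set: nat * nat]
    (fun '(i, m) n => if (n <= m)%N then T i m (v i (m - n)%N) else 0) ->
  uniformly_unconditionally_convergent q [set: nat * nat]
    (fun '(i, m) n => T i m (v i (m + n)%N)) ->
  uniformly_unconditionally_convergent q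
    [set l : nat * nat * nat | l.1.1 <> l.1.2]
    (fun '(i, j, m) n =>
       if (c - 1) * m%:R <= n%:R then T i m (v j (m + n)%N) else 0) ->
  uniformly_unconditionally_convergent q
    [set l : nat * nat * nat | l.1.1 <> l.1.2]
    (fun '(i, j, m) n =>
       if ((c - 1) / c * m%:R <= n%:R) && (n <= m)%N
       then T i m (v j (m - n)%N) else 0) ->
  exists N, forall i j m r, uniq r ->
    {in r, forall n, ((n < m)%N ->
                        (n + N <= m)%N /\ (i <> j -> c * n%:R <= m%:R)) /\
                     ((m <= n)%N ->
                        (m + N <= n)%N /\ (i <> j -> c * m%:R <= n%:R))} ->
    q (\sum_(n <- r) T i m (v j n)) < e.
Proof.
move=> c_gt1 e_gt0 H1 H2 H3 H4.
have e2_gt0 : 0 < e / 2 by rewrite divr_gt0.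
have [N1 HN1] := @sum_before_small _ _ _ _ q T v _ _ c_gt1 e2_gt0 H1 H4.
have [N2 HN2] := @sum_after_small _ _ _ _ q T v _ _ e2_gt0 H2 H3.
exists (maxn N1 N2) => i j m r r_uniq rP.
rewrite (bigID (fun n => (n < m)%N))/= -big_filter -[X in _ + X]big_filter.
rewrite (splitr e) (le_lt_trans (F_norm_triangle qF _ _))// ltrD//.
  apply: HN1; first exact: filter_uniq.
  move=> n; rewrite mem_filter => /andP[nm /rP[/(_ nm)[le cle] _]].
  by split=> //; lia.
apply: HN2; first exact: filter_uniq.
move=> n; rewrite mem_filter -leqNgt => /andP[mn /rP[_ /(_ mn)[le cle]]].
by split=> //; lia.
Qed.

(** * Enumerations *)

(** Approximate each point d of a countable dense set, identified by its index
    n, within 1/(k+1) by a point of Y0, for every k. *)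
Lemma exists_dense_sequence (R : realType) (K : numFieldType)
  (Y : topologicalLmodType K) (q : Y -> R) (qF : F_norm q)
  (Y0 : set Y) : separable Y -> dense Y0 ->
  exists g : nat -> Y0, forall U : set Y, open U -> U !=set0 ->
    exists k, exists2 e : R, 0 < e & [set y | q (y - \val (g k)) < e] `<=` U.
Proof.
move=> [D /countable_injP[f f_inj] D_dense] Y0_dense.
have dense_ball (A : set Y) (y : Y) (e : R) : dense A -> 0 < e ->
    exists2 a, A a & q (a - y) < e.
  move=> A_dense e_gt0.
  have : nbhs y [set a | q (a - y) < e] by apply/(F_norm_nbhs qF); exists e.
  rewrite nbhsE => -[B [B_open By] BA].
  by have [a [/BA/= ? ?]] := A_dense B (ex_intro _ _ By) B_open; exists a.
have [y0 Y0y0] : Y0 !=set0.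
  by have [a ? _] := dense_ball Y0 0 1 Y0_dense ltr01; exists a.
have /choice[g gP] : forall nk : nat * nat, exists y : Y0,
    forall d, D d -> f d = nk.1 -> q (\val y - d) < nk.2.+1%:R^-1.
  move=> [n k] /=; have [[d [Dd fd]]|nd] := pselect (exists d, D d /\ f d = n).
    have [|y Y0y yd] := dense_ball Y0 d k.+1%:R^-1 Y0_dense.
      by rewrite invr_gt0.
    exists (exist _ y (mem_set Y0y)) => d' Dd' fd'.
    by rewrite (f_inj d' d)// ?inE// fd'.
  by exists (exist _ y0 (mem_set Y0y0)) => d Dd fd; case: nd; exists d.
exists (fun p : nat => g (odflt (0, 0)%N (choice.unpickle p))).
move=> U U_open [u Uu].
have /(F_norm_nbhs qF)[e e_gt0 eU] : nbhs u U by apply: open_nbhs_nbhs.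
have e3_gt0 : 0 < e / 3 by rewrite divr_gt0.
have [k ke] : exists k : nat, k.+1%:R^-1 < e / 3.
  exists (Num.truncn (e / 3)^-1).
  by rewrite -[ltRHS]invrK ltf_pV2 ?posrE ?invr_gt0// truncnS_gt.
have [d Dd du] := dense_ball D u _ D_dense e3_gt0.
exists (choice.pickle (f d, k)), (e / 3) => //.
rewrite choice.pickleK /= => y /= yg.
apply: eU => /=; have := gP (f d, k) d Dd erefl; move: (g _) yg => y1 yg y1d.
rewrite -(subrKA (\val y1)) -(subrKA d (\val y1)).
have := F_norm_triangle qF (y - \val y1) (\val y1 - d + (d - u)).
have := F_norm_triangle qF (\val y1 - d) (d - u).
by have := lt_trans y1d ke; lra.
Qed.

(** Take for [w p] the pair coded by the exponent of 2 in p+1: every exponent is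
    attained infinitely often. *)
Lemma exists_recurrent_pairs :
  exists w : nat -> nat * nat, forall a P, exists2 p, (P <= p)%N & w p = a.
Proof.
exists (fun p => odflt (0, 0)%N (choice.unpickle (logn 2 p.+1))) => a P.
exists (2 ^ choice.pickle a * P.*2.+1).-1%N.
  have : (P.*2.+1 <= 2 ^ choice.pickle a * P.*2.+1)%N.
    by rewrite leq_pmull ?expn_gt0.
  by lia.
by rewrite prednK ?muln_gt0 ?expn_gt0// logn2_odd_multiple choice.pickleK.
Qed.

(** This turns a bound governed by the larger index into one that is summable
    over either index. *)
Lemma quarter_pow_max (R : realType) (p r : nat) :
  (4 : R) ^- maxn p r <= 2 ^- p * 2 ^- r.
Proof.
rewrite -invfM -exprD (_ : 4 = 2 ^+ 2 :> R); last by rewrite expr2 -natrM.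
rewrite -exprM lef_pV2 ?posrE ?exprn_gt0//.
by rewrite ler_weXn2l ?ler1n//; lia.
Qed.

(** * The frequently universal vector *)

Theorem theorem1p4 (R : realType) (s : scalars)
    (X Y : topologicalLmodType (scalar_field R s))
    (X_F : F_space R X) (Y_F : F_space R Y) (Y_sep : separable Y)
    (qX : X -> R) (qX_norm : F_norm qX)
    (qY : Y -> R) (qY_norm : F_norm qY)
    (T : nat -> nat -> {linear X -> Y})
    (T_cont : forall i n, continuous (T i n))
    (Y0 : set Y) (Y0_dense : dense Y0)
    (S : nat -> nat -> Y0 -> X)
    (c : R) (c_gt1 : 1 < c)
    (H1 : forall y : Y0,
      uniformly_unconditionally_convergent qY [set: nat * nat]
        (fun '(i, m) n =>
           if (n <= m)%N then T i m (S i (m - n)%N y) else 0))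
    (H2 : forall y : Y0,
      uniformly_unconditionally_convergent qY [set: nat * nat]
        (fun '(i, m) n => T i m (S i (m + n)%N y)))
    (H3 : forall y : Y0,
      uniformly_unconditionally_convergent qY
        [set l : nat * nat * nat | l.1.1 <> l.1.2]
        (fun '(i, j, m) n =>
           if (c - 1) * m%:R <= n%:R then T i m (S j (m + n)%N y) else 0))
    (H4 : forall y : Y0,
      uniformly_unconditionally_convergent qY
        [set l : nat * nat * nat | l.1.1 <> l.1.2]
        (fun '(i, j, m) n =>
           if ((c - 1) / c * m%:R <= n%:R) && (n <= m)%N
           then T i m (S j (m - n)%N y) else 0))
    (H5 : forall y : Y0,
      uniformly_unconditionally_convergent qX [set: nat]
        (fun i n => S i n y))
    (H6 : forall y : Y0, forall e : R, 0 < e ->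
      exists N : nat, forall n, (N <= n)%N ->
        forall i, qY (T i n (S i n y) - \val y) < e) :
  exists x : X, forall i : nat, frequently_universal R (T i) x.
Proof.
have [g g_dense] := exists_dense_sequence qY_norm Y_sep Y0_dense.
have [w w_rec] := exists_recurrent_pairs.
pose j p := (w p).1; pose y p := g (w p).2.
(* Beyond the threshold f (r, p), all error terms due to y p are below 4^-r. *)
have /choice[f fP] : forall rp : nat * nat, exists N,
    [/\ forall i j m t, uniq t ->
          {in t, forall n,
             ((n < m)%N -> (n + N <= m)%N /\ (i <> j -> c * n%:R <= m%:R)) /\
             ((m <= n)%N -> (m + N <= n)%N /\ (i <> j -> c * m%:R <= n%:R))} ->
          qY (\sum_(n <- t) T i m (S j n (y rp.2))) < 4 ^- rp.1,
        forall t, uniq t -> {in t, forall n, (N <= n)%N} ->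
          forall i, qX (\sum_(n <- t) S i n (y rp.2)) < 4 ^- rp.1 &
        forall n, (N <= n)%N ->
          forall i, qY (T i n (S i n (y rp.2)) - \val (y rp.2)) < 4 ^- rp.1].
  move=> [r p] /=; set e := 4 ^- _.
  have e_gt0 : 0 < e by rewrite invr_gt0 exprn_gt0.
  have [N1 HN1] := sum_off_diagonal_small (T := fun i n => T i n)
    (v := fun i n => S i n (y p)) qY_norm c_gt1 e_gt0
    (H1 (y p)) (H2 (y p)) (H3 (y p)) (H4 (y p)).
  have [N2 HN2] := uuc_uniq_seq (H5 (y p)) e_gt0.
  have [N3 HN3] := H6 (y p) e e_gt0.
  exists (maxn N1 (maxn N2 N3)); split.
  - move=> i i' m t t_uniq tP; apply: HN1 => // n /tP[lt ge].
    by split=> [/lt|/ge] [le cle]; split=> //; lia.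
  - by move=> t t_uniq tP i; apply: HN2 => // n /tP; lia.
  - by move=> n nN i; apply: HN3; lia.
(* N r serves all p <= r at once, so that a gap of max (N r) (N p) is always
   beyond the threshold f (max r p, p). *)
pose N r := \max_(p < r.+1) f (r, val p).
have N_ge r p : (p <= r)%N -> (f (r, p) <= N r)%N.
  by rewrite -ltnS => pr; exact: (leq_bigmax (Ordinal pr)).
have N_max r p : (f (maxn r p, p) <= maxn (N r) (N p))%N.
  have : N (maxn r p) = N r \/ N (maxn r p) = N p.
    by rewrite maxnE; case: (leqP p r) => rp; [left|right]; congr N; lia.
  have := N_ge _ _ (leq_maxr r p).
  by move=> le [e|e]; rewrite (leq_trans le)// e leq_max leqnn ?orbT.
have [lab [lab_ge lab_gap lab_ratio lab_dens]] := exists_separated_labels c N.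
pose z n := if lab n is Some p then S (j p) n (y p) else 0.
have z_lab t p : \sum_(n <- t | lab n == Some p) z n =
    \sum_(n <- [seq n <- t | lab n == Some p]) S (j p) n (y p).
  by rewrite big_filter; apply: eq_bigr => n /eqP ln; rewrite /z ln.
have z_none n : lab n = None -> z n = 0 by rewrite /z => ->.
have z_tail r t : uniq t -> {in t, forall n, (N r <= n)%N} ->
    qX (\sum_(n <- t) z n) <= 2 * 2 ^- r.
  move=> t_uniq tN; apply: (F_norm_sum_labels qX_norm _ z_none) => [|p].
    by rewrite invr_ge0 exprn_ge0.
  rewrite z_lab (le_trans _ (quarter_pow_max R r p))// ltW//.
  have [_ + _] := fP (maxn r p, p); apply; first exact: filter_uniq.
  move=> n; rewrite mem_filter => /andP[/eqP ln nt].
  by have := N_max r p; have := lab_ge _ _ ln; have := tN _ nt;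
    move: (f _) => F; lia.
have small_pow (e : R) : 0 < e -> exists P, forall p, (P <= p)%N ->
    3 * 2 ^- p < e.
  move=> e_gt0; exists (Num.truncn (3 / e)).+1 => p Pp.
  rewrite ltr_pdivrMr ?exprn_gt0// mulrC -ltr_pdivrMr//.
  apply: (lt_le_trans (truncnS_gt _)); rewrite -natrX ler_nat.
  by rewrite (leq_trans Pp)// ltnW// ltn_expl.
have [x x_lim] : exists x : X,
    (fun n => \sum_(0 <= k < n) z k) @ \oo --> x.
  apply: (cauchy_series_cvg qX_norm X_F.1) => e e_gt0.
  have [P /(_ P (leqnn P)) HP] := small_pow e e_gt0.
  exists (N P) => m n /andP[Nm _]; apply: le_lt_trans HP.
  apply: (@le_trans _ _ (2 * 2 ^- P)).
    apply: z_tail; first exact: iota_uniq.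
    by move=> k; rewrite mem_index_iota => /andP[+ _]; exact: leq_trans.
  by rewrite ler_wpM2r ?ler_nat// invr_ge0 exprn_ge0.
have Tx m p : lab m = Some p ->
    qY (T (j p) m x - \val (y p)) <= 3 * 2 ^- p.
  move=> lm.
  have Tx_lim : (fun n => T (j p) m (\sum_(0 <= k < n) z k)) @ \oo -->
      T (j p) m x by apply: continuous_cvg => //; exact: T_cont.
  apply: (F_norm_lim_le qY_norm Tx_lim); exists m.+1 => // M /= mM.
  (* Only the diagonal term n = m contributes significantly. *)
  rewrite linear_sum (bigD1_seq m) ?iota_uniq ?mem_index_iota//= addrAC.
  have -> : 3 * 2 ^- p = 2 ^- p + 2 * 2 ^- p :> R by ring.
  rewrite (le_trans (F_norm_triangle qY_norm _ _))// lerD//.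
    rewrite /z lm (@le_trans _ _ (4 ^- p))//.
      have [_ _ H] := fP (p, p); apply/ltW/H.
      by rewrite (leq_trans (N_ge p p (leqnn p)))// lab_ge.
    by rewrite lef_pV2 ?posrE ?exprn_gt0// lerXn2r ?nnegrE// ler_nat.
  rewrite -big_filter; apply: (F_norm_sum_labels qY_norm (lab := lab)).
  - by rewrite invr_ge0 exprn_ge0.
  - by move=> n /z_none ->; rewrite linear0.
  move=> p'; rewrite -big_filter.
  rewrite (eq_big_seq (fun n => T (j p) m (S (j p') n (y p')))); last first.
    by move=> n; rewrite mem_filter /z => /andP[/eqP -> _].
  rewrite (le_trans _ (quarter_pow_max R p p'))// ltW//.
  have [+ _ _] := fP (maxn p p', p'); apply.
    by rewrite !filter_uniq// iota_uniq.
  move=> n; rewrite !mem_filter => /and3P[/eqP ln nm _].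
  have pp' : j p <> j p' -> p <> p' by move=> jj e; rewrite e in jj.
  move: (f _) (N_max p p') => F F_le; split=> [lt_nm|le_mn].
    split; last by move=> /pp' ?; apply: lab_ratio ln lm lt_nm _ => /esym.
    by have := lab_gap _ _ _ _ ln lm lt_nm; lia.
  have lt_mn : (m < n)%N by rewrite ltn_neqAle eq_sym nm.
  split; last by move=> /pp' ?; apply: lab_ratio lm ln lt_mn _.
  by have := lab_gap _ _ _ _ lm ln lt_mn; lia.
exists x => i U U_open U0.
have [k [e e_gt0 eU]] := g_dense U U_open U0.
have [P HP] := small_pow e e_gt0.
have [p /HP pe wp] := w_rec (i, k) P.
have [K [n0 cnt]] := lab_dens p.
apply: (lower_density_gt0 R _ cnt) => m /eqP lm.
apply: eU; rewrite /= (le_lt_trans _ pe)//.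
by have := Tx _ _ lm; rewrite /j /y wp.
Qed.
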